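(* Let $n\ge4$ be an integer. Then for any $\mu\in\mathfrak{P}_{n-1,2n-4}$ with $|\mu|\ge n-1$, we have $$\mathscr{C}_{\mu,n-1,n-3}=\mathscr{C}_{\mu,n-2,n-2}.$$
   Context: For positive integers $m,k$, $\mathfrak{P}_{m,k}$ is the set of $m$-tuples of nonnegative integers $p=(p_1,\dots,p_m)$ with $p_1+2p_2+\cdots+mp_m=k$; put $|p|=p_1+\cdots+p_m$ and $\mathfrak{P}_k=\mathfrak{P}_{k,k}$. Write $\binom{|p|}{p_1,\dots,p_m}=\frac{|p|!}{p_1!\cdots p_m!}$. Let $k_1\ge k_2$ be positive integers and $\mu=(\mu_1,\dots,\mu_{k_1})\in\mathfrak{P}_{k_1,k_1+k_2}$. For $p\in\mathfrak{P}_{k_1}$ and $q\in\mathfrak{P}_{k_2}$ put $p+q=(p_1+q_1,\dots,p_{k_2}+q_{k_2},p_{k_2+1},\dots,p_{k_1})$. Define $$\mathscr{C}_{\mu,k_1,k_2}=\sum_{p\in\mathfrak{P}_{k_1},\,q\in\mathfrak{P}_{k_2},\,p+q=\mu}\binom{|p|}{p_1,\dots,p_{k_1}}\binom{|q|}{q_1,\dots,q_{k_2}},$$ with $\mathscr{C}_{\mu,k_1,k_2}=0$ if there are no such $p,q$. For $n\ge4$, any $\mu\in\mathfrak{P}_{n-1,2n-4}$ with $|\mu|\ge n-1$ has $\mu_{n-1}=0$, so $\mu$ is also considered as an element $(\mu_1,\dots,\mu_{n-2})$ of $\mathfrak{P}_{n-2,2n-4}$; this is the meaning of $\mu$ in $\mathscr{C}_{\mu,n-2,n-2}$.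 *)

(* Defs.v *)
From mathcomp Require Import all_boot.

Set Implicit Arguments.
Unset Strict Implicit.
Unset Printing Implicit Defensive.

(* An m-tuple p of nonnegative integers is p : {ffun 'I_m -> nat}; indices
   start at 0, so that p i is the mathematical p_{i+1}. *)

Definition weight (m : nat) (p : {ffun 'I_m -> nat}) : nat :=
  \sum_(i < m) i.+1 * p i.

(* |p| *)
Definition nb_parts (m : nat) (p : {ffun 'I_m -> nat}) : nat :=
  \sum_(i < m) p i.

(* An m-tuple of weight k has all its entries at most k, hence is the image of
   a finite function with values in 'I_k.+1; see mem_parts and parts_uniq. *)
Definition parts (m k : nat) : seq {ffun 'I_m -> nat} :=
  [seq p <- [seq [ffun i => f i : nat] | f : {ffun 'I_m -> 'I_k.+1}]
  | weight p == k].

Definition multinom (m : nat) (p : {ffun 'I_m -> nat}) : nat :=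
  (nb_parts p)`! %/ \prod_(i < m) (p i)`!.

(* Pads with zeros if m <= l, keeps the first l entries if l <= m. *)
Definition resize (m l : nat) (p : {ffun 'I_m -> nat}) : {ffun 'I_l -> nat} :=
  [ffun i : 'I_l => oapp p 0 (insub (i : nat))].

Definition add_parts (k1 k2 : nat) (p : {ffun 'I_k1 -> nat})
    (q : {ffun 'I_k2 -> nat}) : {ffun 'I_k1 -> nat} :=
  [ffun i => p i + resize k1 q i].

Definition coefC (k1 k2 : nat) (mu : {ffun 'I_k1 -> nat}) : nat :=
  \sum_(p <- parts k1 k1) \sum_(q <- parts k2 k2 | add_parts p q == mu)
    multinom p * multinom q.

Arguments coefC : clear implicits.

Lemma mem_parts (m k : nat) (p : {ffun 'I_m -> nat}) :
  (p \in parts m k) = (weight p == k).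
Proof.
rewrite mem_filter; case: eqP => //= wp.
have pk i : p i < k.+1.
  rewrite ltnS -wp /weight (bigD1 i) //=.
  by apply: leq_trans (leq_addr _ _); rewrite leq_pmull.
apply/mapP; exists [ffun i => Ordinal (pk i)]; first by rewrite mem_enum.
by apply/ffunP => i; rewrite !ffunE.
Qed.

Lemma parts_uniq (m k : nat) : uniq (parts m k).
Proof.
apply: filter_uniq; rewrite map_inj_uniq ?enum_uniq // => f g /ffunP fg.
by apply/ffunP => i; apply: val_inj; move: (fg i); rewrite !ffunE.
Qed.

(* The division in multinom is exact. *)
Lemma multinomE (m : nat) (p : {ffun 'I_m -> nat}) :
  multinom p * \prod_(i < m) (p i)`! = (nb_parts p)`!.
Proof.
apply: divnK; rewrite /nb_parts.
apply: (big_ind2 (fun a b => a %| b`!)) => // a x b y ax biy.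
have xy : x <= x + y by rewrite leq_addr.
by rewrite -(bin_fact xy) addKn dvdn_mull // dvdn_mul.
Qed.

(* The last entry of such a mu vanishes, so dropping it keeps the weight. *)
Lemma resize_parts (n : nat) (mu : {ffun 'I_(n - 1) -> nat}) :
  4 <= n -> mu \in parts (n - 1) (2 * n - 4) -> n - 1 <= nb_parts mu ->
  resize (n - 1) (resize (n - 2) mu) = mu /\
  resize (n - 2) mu \in parts (n - 2) (2 * n - 4).
Proof.
case: n mu => [|[|n]] // mu n4.
rewrite (_ : 2 * n.+2 - 4 = n + n); last first.
  by rewrite mul2n !doubleS !subSS subn0 addnn.
rewrite !mem_parts => /eqP wmu tmu.
move: mu wmu tmu; rewrite !subSS !subn0 => mu wmu tmu.
have mu0 : mu ord_max = 0.
  apply/eqP; rewrite -leqn0 leqNgt; apply/negP => mu_gt0.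
  have : n + n.+1 <= weight mu.
    rewrite /weight big_ord_recr /=.
    apply: (@leq_trans (n * mu ord_max + nb_parts mu)).
      by apply: leq_add => //; rewrite leq_pmulr.
    rewrite /nb_parts big_ord_recr /= mulSn [mu _ + _]addnC addnCA leq_add //.
    by apply: leq_sum => i _; rewrite leq_pmull.
  by rewrite wmu addnS ltnn.
have resE (i : 'I_n) : resize n mu i = mu (widen_ord (leqnSn n) i).
  rewrite ffunE; case: insubP => [j _ ji|]; last by rewrite ltnS ltnW.
  by congr (mu _); apply: val_inj.
split; last first.
  rewrite -wmu; apply/eqP; rewrite /weight big_ord_recr /= mu0 muln0 addn0.
  by apply: eq_bigr => i _; rewrite resE.
apply/ffunP => i; rewrite ffunE; case: insubP => [j _ ji|] /=.
  by rewrite resE; congr (mu _); apply: val_inj.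
rewrite -leqNgt => ni; rewrite -[LHS]mu0; congr (mu _); apply: val_inj => /=.
by apply/eqP; rewrite eqn_leq ni -ltnS ltn_ord.
Qed.

(* Main.v *)
(* C_{mu,k1,k2} counts the pairs (u, v) of compositions of k1 and k2 whose parts
   together have multiplicities mu.  Let m = n - 2.  For pairs of total sum 2m
   with at least m + 1 parts and sums (m + 1, m - 1) or (m, m), the pigeonhole
   principle yields x such that x + 1 is a partial sum of u and x is a partial
   sum of v.  Exchanging the tails of u and v at the smallest such x is an
   involution which swaps the two kinds of pairs. *)
Require Import Defs.
From mathcomp Require Import all_boot zify.

Set Implicit Arguments.
Unset Strict Implicit.
Unset Printing Implicit Defensive.

(** * Multinomial coefficients as numbers of arrangements *)

(** Induction on the size of [s], splitting by the first letter [x]: removing [x] divides the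
    product of factorials by [count_mem x s], and these counts sum to [size s]. Elements of [r]
    outside [s] contribute factors 1, so [r] may be a full index range. *)
Lemma size_permutations_fact (T : eqType) (r s : seq T) :
    uniq r -> {subset s <= r} ->
  size (permutations s) * \prod_(x <- r) (count_mem x s)`! = (size s)`!.
Proof.
move=> Ur; have [n] := ubnP (size s); elim: n s => // n IHn s.
have [-> _ _|/negPf s_n0 lt_sn srs] := eqVneq s [::].
  by rewrite mul1n big1.
have szE : \sum_(x <- undup s) count_mem x s = size s.
  rewrite -(perm_size (perm_count_undup s)) size_flatten /shape -map_comp.
  by rewrite sumnE big_map; apply: eq_bigr => x _; rewrite /= size_nseq.
have s_gt0 : 0 < size s by rewrite lt0n size_eq0 s_n0.
rewrite (perm_size (permutationsE s_gt0)).
rewrite -sum1_size big_allpairs_dep /= big_distrl /=.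
transitivity (\sum_(x <- undup s) count_mem x s * (size s).-1`!); last first.
  by rewrite -big_distrl /= szE -{1 3}(prednK s_gt0) factS.
apply: eq_big_seq => x; rewrite mem_undup => sx; rewrite sum1_size.
have rx := srs x sx.
have <- : size (permutations (rem x s)) *
    \prod_(y <- r) (count_mem y (rem x s))`! = (size s).-1`!.
  rewrite IHn ?size_rem //; first by lia.
  by move=> y /mem_rem /srs.
rewrite (bigD1_seq x) //= [in RHS](bigD1_seq x) //=.
have /permP cs := perm_to_rem sx.
rewrite !cs /= eqxx factS.
rewrite (eq_bigr (fun y => (count_mem y (rem x s))`!)); first by lia.
by move=> y yx; rewrite cs /= eq_sym (negPf yx).
Qed.

(** * Words, their contents, and pairs of words *)

(* A word is a composition whose letter [i] stands for a part of size [i.+1],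
   so that letters index the entries of a tuple. *)
Definition wt (u : seq nat) : nat := \sum_(i <- u) i.+1.

Definition content (m : nat) (u : seq nat) : {ffun 'I_m -> nat} :=
  [ffun i : 'I_m => count_mem (i : nat) u].

Definition word (m : nat) (p : {ffun 'I_m -> nat}) : seq nat :=
  flatten [seq nseq (p i) (val i) | i <- enum 'I_m].

Definition words (m k : nat) : seq (seq nat) :=
  [seq u | p <- parts m k, u <- permutations (word p)].

Lemma wt_nil : wt [::] = 0. Proof. exact: big_nil. Qed.

Lemma wt_cons i u : wt (i :: u) = i.+1 + wt u. Proof. exact: big_cons. Qed.

Lemma wt_cat u v : wt (u ++ v) = wt u + wt v. Proof. exact: big_cat. Qed.

Lemma wt_mem i u : i \in u -> i < wt u.
Proof.
by move=> ui; rewrite /wt (perm_big _ (perm_to_rem ui)) big_cons leq_addr.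
Qed.

Lemma all_wt u m : wt u <= m -> all (gtn m) u.
Proof. by move=> um; apply/allP => i /wt_mem iu; apply: leq_trans um. Qed.

Lemma resize_content m l u : all (gtn m) u -> resize l (content m u) = content l u.
Proof.
move=> /allP um; apply/ffunP => i; rewrite !ffunE.
case: insubP => [j _ <-|] /=; first by rewrite ffunE.
by move=> im; apply/esym/count_memPn; apply: contra im => /um.
Qed.

Lemma big_word (m : nat) (p : {ffun 'I_m -> nat}) (F : nat -> nat) :
  \sum_(i <- word p) F i = \sum_(i < m) F i * p i.
Proof.
rewrite big_flatten big_map big_enum /=; apply: eq_bigr => i _.
by rewrite big_nseq iter_addn_0.
Qed.

Lemma wt_word m (p : {ffun 'I_m -> nat}) : wt (word p) = weight p.
Proof. exact: big_word. Qed.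

Lemma size_word m (p : {ffun 'I_m -> nat}) : size (word p) = nb_parts p.
Proof. by rewrite -sum1_size big_word; apply: eq_bigr => i _; rewrite mul1n. Qed.

Lemma all_word m (p : {ffun 'I_m -> nat}) : all (gtn m) (word p).
Proof.
by apply/allP => i /flatten_mapP[j _]; rewrite mem_nseq => /andP[_ /eqP->] /=.
Qed.

Lemma wordK m : cancel (@word m) (content m).
Proof.
move=> p; apply/ffunP => i; rewrite ffunE -sum1_count big_mkcond big_word.
rewrite (bigD1 i) //= eqxx mul1n big1 ?addn0 // => j ji.
by rewrite (negPf (ji : val j != val i)).
Qed.

Lemma contentK m u : all (gtn m) u -> perm_eq u (word (content m u)).
Proof.
move=> um; apply/allP => i; rewrite mem_cat => iw.
have im : i < m.
  by case/orP: iw => [/(allP um)//|/(allP (all_word _))].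
have /ffunP/(_ (Ordinal im)) := wordK (content m u).
by rewrite !ffunE /= => ->.
Qed.

Lemma perm_content m u v : perm_eq u v -> content m u = content m v.
Proof. by move=> /permP uv; apply/ffunP => i; rewrite !ffunE uv. Qed.

Lemma multinom_word m (p : {ffun 'I_m -> nat}) :
  multinom p = size (permutations (word p)).
Proof.
have F_gt0 : 0 < \prod_(i < m) (p i)`! by apply: prodn_gt0 => i; apply: fact_gt0.
apply/eqP; rewrite -(eqn_pmul2r F_gt0) multinomE -size_word.
rewrite -(@size_permutations_fact _ (iota 0 m)) ?iota_uniq //; last first.
  by move=> i /(allP (all_word p)) im; rewrite mem_iota.
apply/eqP; congr (_ * _); rewrite -[m in iota 0 m]subn0 big_mkord.
apply: eq_bigr => i _; rewrite -{2}(wordK p) ffunE.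
by congr (_`!).
Qed.

(** The bound [k <= m] keeps every letter of a word of weight [k] below [m], so [content m] loses
    none of them. *)
Lemma mem_words m u k : k <= m -> (u \in words m k) = (wt u == k).
Proof.
move=> km; apply/allpairsPdep/eqP => [[p [v [+ + ->]]]|uk].
  rewrite mem_parts mem_permutations => /eqP <- pu.
  by rewrite -wt_word /wt (perm_big _ pu).
have um : all (gtn m) u by apply: all_wt; rewrite uk.
exists (content m u), u; rewrite mem_parts mem_permutations contentK //.
by rewrite -wt_word -{1}uk /wt (perm_big _ (contentK um)).
Qed.

(** Different tuples give disjoint blocks, since [content] recovers the tuple from any rearrangement
    of its word. *)
Lemma words_uniq m k : uniq (words m k).
Proof.
apply: allpairs_uniq_dep => [|p _|]; rewrite ?parts_uniq ?permutations_uniq //.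
move=> x y /allpairsPdep[p [u [_ pu ->]]] /allpairsPdep[q [v [_ qv ->]]] /= uv.
rewrite !mem_permutations in pu qv; rewrite -uv in qv *.
by rewrite -(wordK p) -(perm_content _ pu) (perm_content _ qv) wordK.
Qed.

Definition pairs (k1 k2 : nat) (mu : {ffun 'I_k1 -> nat}) :
    seq (seq nat * seq nat) :=
  [seq w <- [seq (u, v) | u <- words k1 k1, v <- words k2 k2] |
    content k1 (w.1 ++ w.2) == mu].

Lemma pairs_uniq k1 k2 mu : uniq (@pairs k1 k2 mu).
Proof.
by apply: filter_uniq; apply: allpairs_uniq; rewrite ?words_uniq // => -[? ?] [].
Qed.

Lemma mem_pairs k1 k2 (mu : {ffun 'I_k1 -> nat}) u v :
  ((u, v) \in pairs k2 mu) =
  [&& wt u == k1, wt v == k2 & content k1 (u ++ v) == mu].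
Proof.
rewrite mem_filter andbC /= andbA; congr (_ && _).
rewrite -(mem_words u (leqnn k1)) -(mem_words v (leqnn k2)).
by apply/allpairsP/andP => [[[u' v'] [? ? [-> ->]]]|[? ?]] //; exists (u, v).
Qed.

(** Each admissible [(p, q)] accounts for the [multinom p * multinom q] pairs of arrangements of
    [word p] and [word q]; contents add up under concatenation. *)
Lemma coefC_pairs k1 k2 (mu : {ffun 'I_k1 -> nat}) :
  coefC k1 k2 mu = size (pairs k2 mu).
Proof.
rewrite size_filter -sum1_count big_mkcond big_allpairs /= big_allpairs_dep /=.
apply: eq_big_seq => p; rewrite mem_parts => /eqP wp.
rewrite exchange_big big_allpairs_dep /= big_mkcond.
apply: eq_big_seq => q; rewrite mem_parts => /eqP wq.
transitivity (\sum_(v <- permutations (word q)) \sum_(u <- permutations (word p))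
    if add_parts p q == mu then 1 else 0).
  rewrite !big_const_seq !count_predT !iter_addn_0.
  by rewrite -!multinom_word; case: ifP; lia.
apply: eq_big_seq => v; rewrite mem_permutations => qv.
apply: eq_big_seq => u; rewrite mem_permutations => pu.
suff -> : add_parts p q = content k1 (u ++ v) by [].
apply/ffunP => i; rewrite [LHS]ffunE [RHS]ffunE count_cat.
rewrite -{1}(wordK p) -{1}(wordK q).
rewrite resize_content ?all_word // -(perm_content _ pu) -(perm_content _ qv).
by rewrite !ffunE.
Qed.

(** * Partial sums of a word *)

(* [reach u x] says that [x] is a partial sum of the parts of [u], in which case
   [pos u x] is the length of the corresponding prefix. *)
Fixpoint reach (u : seq nat) (x : nat) : bool :=
  (x == 0) ||
  if u is i :: u' then (i.+1 <= x) && reach u' (x - i.+1) else false.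

Fixpoint pos (u : seq nat) (x : nat) : nat :=
  if u is i :: u' then if i.+1 <= x then (pos u' (x - i.+1)).+1 else 0 else 0.

Lemma reach0 u : reach u 0. Proof. by case: u. Qed.

Lemma reach_catl u v x : x <= wt u -> reach (u ++ v) x = reach u x.
Proof.
elim: u x => [|i u IHu] x.
  by rewrite wt_nil leqn0 => /eqP ->; apply: reach0.
rewrite wt_cons /= => xu; case: leqP => //= ix.
by rewrite IHu // leq_subLR.
Qed.

Lemma pos_cat u v : pos (u ++ v) (wt u) = size u.
Proof.
elim: u => [|i u IHu]; first by rewrite wt_nil; case: v.
by rewrite wt_cons /= leq_addr addKn IHu.
Qed.

Lemma reachP u x : reflect (exists v w, u = v ++ w /\ wt v = x) (reach u x).
Proof.
apply: (iffP idP) => [|[v [w [-> <-]]]]; last first.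
  rewrite reach_catl //; elim: v => [|i v IHv]; first by rewrite wt_nil.
  by rewrite wt_cons /= leq_addr addKn IHv.
elim: u x => [|i u IHu] [|x] //=; try by exists [::]; eexists; rewrite wt_nil.
case/andP=> ix /IHu[v [w [-> vx]]]; exists (i :: v), w.
by rewrite wt_cons vx subnKC.
Qed.

(** Parts are positive, so the partial sums below the total correspond to the proper prefixes, the
    empty one included: one per letter. *)
Lemma count_reach u : count (reach u) (iota 0 (wt u)) = size u.
Proof.
elim: u => [|i u IHu]; first by rewrite wt_nil.
rewrite wt_cons iotaD count_cat add0n -[X in iota X (wt u)]addn0 iotaDl.
rewrite count_map /= -IHu; congr (_.+1).
rewrite (eq_in_count (a2 := pred0)) => [|x]; last first.
  by rewrite mem_iota /= => /andP[x0 xi]; rewrite leqNgt xi -leqn0 leqNgt x0.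
rewrite count_pred0; apply: eq_count => x /=.
by rewrite leq_addr addKn.
Qed.

(** The previous count, with the partial sum 0 traded for the total. *)
Lemma count_reachS u :
  count (fun x => reach u x.+1) (iota 0 (wt u)) = size u.
Proof.
have ru : reach u (wt u) by apply/reachP; exists u, [::]; rewrite cats0.
have : count (reach u) (iota 0 (wt u).+1) = (size u).+1.
  by rewrite -addn1 iotaD count_cat count_reach /= ru addn1.
by rewrite /= reach0 add1n (iotaDl 1 0) count_map => -[].
Qed.

(** * Cuts and the exchange of tails *)

(** The offset of one makes the exchange of tails send weights [(a, b)] to [(b + 1, a - 1)]. *)
Definition cut (w : seq nat * seq nat) (x : nat) : bool :=
  reach w.1 x.+1 && reach w.2 x.

(** The search bound exceeds every cut [x], because [x.+1] is at most the weight of the first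
    word. *)
Definition first_cut (w : seq nat * seq nat) : nat :=
  find (cut w) (iota 0 (wt (w.1 ++ w.2))).

Definition swap (w : seq nat * seq nat) : seq nat * seq nat :=
  let i := pos w.1 (first_cut w).+1 in let j := pos w.2 (first_cut w) in
  (take i w.1 ++ drop j w.2, take j w.2 ++ drop i w.1).

Lemma first_cutE a b c d :
    wt a = (wt c).+1 -> (forall x, x < wt c -> ~~ cut (a ++ b, c ++ d) x) ->
  first_cut (a ++ b, c ++ d) = wt c.
Proof.
move=> ac min_c; rewrite /first_cut.
have -> : wt ((a ++ b) ++ c ++ d) = wt c + (wt b + wt c + wt d).+1.
  by rewrite !wt_cat ac; lia.
rewrite iotaD find_cat size_iota ifF /=; last first.
  by apply/hasPn => x; rewrite mem_iota => /min_c.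
rewrite ifT ?addn0 // /cut /= add0n -{1}ac.
by apply/andP; split; apply/reachP; [exists a, b | exists c, d].
Qed.

Lemma swap_cut a b c d :
    wt a = (wt c).+1 -> (forall x, x < wt c -> ~~ cut (a ++ b, c ++ d) x) ->
  swap (a ++ b, c ++ d) = (a ++ d, c ++ b).
Proof.
move=> ac min_c; rewrite /swap (first_cutE ac min_c) /= -ac !pos_cat.
by rewrite !take_size_cat // !drop_size_cat.
Qed.

Lemma has_cutP w x : cut w x -> exists a b c d,
  [/\ w = (a ++ b, c ++ d), wt a = (wt c).+1 &
      forall y, y < wt c -> ~~ cut w y].
Proof.
move=> wx; have [y wy min_y] := ex_minnP (ex_intro _ x wx).
case: w {wx} wy min_y => u v /andP[/reachP[a [b [/= -> ay]]]].
case/reachP=> [c [d [/= -> cy]]] min_y; exists a, b, c, d.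
split; rewrite ?cy // => z zy; apply/negP => /min_y.
by rewrite leqNgt zy.
Qed.

(* Below the cut both words keep their partial sums, so the first cut of the
   swapped pair is at the same place. *)
Lemma swapP w x : cut w x ->
  [/\ swap (swap w) = w, wt (swap w).1 = (wt w.2).+1,
      (wt (swap w).2).+1 = wt w.1 &
      perm_eq ((swap w).1 ++ (swap w).2) (w.1 ++ w.2)].
Proof.
case/has_cutP=> a [b [c [d [-> ac min_c]]]]; rewrite (swap_cut ac min_c).
rewrite swap_cut //; last first.
  move=> y yc; move: (min_c y yc); rewrite /cut /=.
  by rewrite !reach_catl // ?ac; lia.
split; rewrite ?wt_cat /= ?wt_cat ?ac //.
by apply/permP => P; rewrite !count_cat; lia.
Qed.

(** * Existence of a cut by counting *)

Lemma cut_ex u v m :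
    count (fun x => reach u x.+1) (iota 0 m) + count (reach v) (iota 0 m) > m ->
  exists x, cut (u, v) x.
Proof.
rewrite -count_predUI => lt_m.
have : has (predI (fun x => reach u x.+1) (reach v)) (iota 0 m).
  rewrite has_count.
  by have := count_size (predU (fun x => reach u x.+1) (reach v)) (iota 0 m);
    rewrite size_iota; lia.
by case/hasP=> x _ ?; exists x.
Qed.

Lemma cut_ex_balanced u v m :
  wt u = m -> wt v = m -> m < size (u ++ v) -> exists x, cut (u, v) x.
Proof.
move=> um vm muv; apply: (@cut_ex _ _ m).
have := count_reach v; have := count_reachS u.
by rewrite um vm => -> ->; rewrite -size_cat.
Qed.

Lemma cut_ex_unbalanced u v m :
  wt u = m.+2 -> wt v = m -> m.+1 < size (u ++ v) -> exists x, cut (u, v) x.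
Proof.
(* For [x] up to [m], [v] also reaches its total [m], while [u] loses its total [m.+2]: the two
   counts still add up to [size u + size v]. *)
move=> um vm muv; apply: (@cut_ex _ _ m.+1).
have rv : reach v m by apply/reachP; exists v, [::]; rewrite cats0.
have ru : reach u m.+2 by apply/reachP; exists u, [::]; rewrite cats0.
have cv : count (reach v) (iota 0 m.+1) = (size v).+1.
  by rewrite -(count_reach v) vm -addn1 iotaD count_cat /= rv addn1.
have cu : (count (fun x => reach u x.+1) (iota 0 m.+1)).+1 = size u.
  by rewrite -(count_reachS u) um -[m.+2]addn1 iotaD count_cat /= ru addn1.
by rewrite cv addnS -addSn cu -size_cat.
Qed.

(** * The bijection between the two families of pairs *)

(** Meant for [swap] in both directions; cancellation is asked on [s1] alone because [swapP] gives
    it for pairs with a cut. *)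
Lemma leq_size_inj (T : eqType) (s1 s2 : seq T) (f : T -> T) :
    uniq s1 -> {in s1, cancel f f} -> {in s1, forall x, f x \in s2} ->
  size s1 <= size s2.
Proof.
move=> Us fK fs; rewrite -(size_map f); apply: uniq_leq_size.
  by rewrite map_inj_in_uniq //; apply: can_in_inj fK.
by move=> _ /mapP[x sx ->]; apply: fs.
Qed.

Lemma size_content m u : all (gtn m) u -> nb_parts (content m u) = size u.
Proof. by move=> um; rewrite -size_word (perm_size (contentK um)). Qed.

Lemma content_widen m u : resize m (content m.+1 u) = content m u.
Proof.
apply/ffunP => i; rewrite !ffunE; case: insubP => [j _ ji|] /=.
  by rewrite ffunE ji.
by rewrite ltnW // ltnS.
Qed.

(** Here [m] is [n - 3]. The first hypothesis says that the last entry of [mu] is 0, so both sides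
    concern the same content; the second provides a cut in every pair. *)
Lemma coefC_shift m (mu : {ffun 'I_m.+2 -> nat}) :
    resize m.+2 (resize m.+1 mu) = mu -> m.+1 < nb_parts mu ->
  coefC m.+2 m mu = coefC m.+1 m.+1 (resize m.+1 mu).
Proof.
move=> muK mu_large; rewrite !coefC_pairs; apply/eqP; rewrite eqn_leq.
have AP w : w \in pairs m mu ->
    [/\ wt w.1 = m.+2, wt w.2 = m, content m.+2 (w.1 ++ w.2) = mu &
        exists x, cut w x].
  case: w => u v; rewrite mem_pairs => /and3P[/eqP um /eqP vm /eqP uv].
  split=> //; apply: (cut_ex_unbalanced um vm).
  rewrite -(@size_content m.+2) ?uv // all_cat.
  by apply/andP; split; apply: all_wt; lia.
have BP w : w \in pairs m.+1 (resize m.+1 mu) ->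
    [/\ wt w.1 = m.+1, wt w.2 = m.+1, content m.+2 (w.1 ++ w.2) = mu &
        exists x, cut w x].
  case: w => u v; rewrite mem_pairs => /and3P[/eqP um /eqP vm /eqP uv].
  (* Both weights are [m.+1], so all letters are below [m.+1] and padding the shorter content by a
     zero gives the longer one. *)
  have uvK : content m.+2 (u ++ v) = mu.
    by rewrite -muK -uv resize_content // all_cat !all_wt ?um ?vm.
  split=> //; apply: (cut_ex_balanced um vm).
  rewrite -(@size_content m.+2) ?uvK // all_cat.
  by apply/andP; split; apply: all_wt; lia.
apply/andP; split; apply: (leq_size_inj (f := swap)); rewrite ?pairs_uniq //.
- by move=> w /AP[_ _ _ [x /swapP[]]].
- move=> w /AP[um vm uv [x /swapP[_ + + /perm_content sw]]].
  case: (swap w) sw => u' v' /= sw u'm v'm; rewrite mem_pairs.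
  by rewrite -(content_widen m.+1) sw uv u'm vm -[wt v' == _]eqSS v'm um !eqxx.
- by move=> w /BP[_ _ _ [x /swapP[]]].
- move=> w /BP[um vm uv [x /swapP[_ + + /perm_content sw]]].
  case: (swap w) sw => u' v' /= sw u'm v'm; rewrite mem_pairs.
  by rewrite sw uv u'm vm -[wt v' == _]eqSS v'm um !eqxx.
Qed.

Theorem proposition4p1 (n : nat) (mu : {ffun 'I_(n - 1) -> nat})
    (hn : 4 <= n) (hmu : mu \in parts (n - 1) (2 * n - 4))
    (htot : n - 1 <= nb_parts mu) :
  coefC (n - 1) (n - 3) mu = coefC (n - 2) (n - 2) (resize (n - 2) mu).
Proof.
have [muK _] := resize_parts hn hmu htot.
case: n mu hn {hmu} htot muK => [|[|[|n]]] // mu _ htot muK.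
have -> : n.+3 - 3 = n by rewrite !subSS subn0.
exact: (@coefC_shift n mu muK htot).
Qed.
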